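(* Let $X$ be a normal pseudomanifold of rank $n \geq 0$. Then, either $\Delta X = \emptyset$ and $X$ is an $n$-surface, or $\Delta X \neq \emptyset$ and $X$ is an $n$-PCM.
   Context: Posets. For a poset $X$ with order $\le$ and $h\in X$, put $\alpha_X(h)=\{h'\in X: h'\le h\}$, $\beta_X(h)=\{h'\in X: h'\ge h\}$, $\theta_X(h)=\alpha_X(h)\cup\beta_X(h)$, and let $\alpha^{\square}_X(h),\beta^{\square}_X(h),\theta^{\square}_X(h)$ be these sets with $h$ removed. Any subset $S\subseteq X$ is regarded as a poset $|S|$ with the induced order. The rank $\mathrm{rk}(h,X)$ is $0$ if $\alpha^{\square}_X(h)=\emptyset$ and $1+\max_{x\in\alpha^{\square}_X(h)}\mathrm{rk}(x,X)$ otherwise; the rank of $X$ is the maximal rank of its elements, and $-1$ if $X=\emptyset$. A $k$-face of $X$ is an element of rank $k$. A path is a finite sequence $\langle p^0,\dots,p^k\rangle$ in $X$ with $p^i\in\theta^{\square}_X(p^{i-1})$ for $1\le i\le k$; $X$ is connected if any two elements are joined by a path in $X$. Discrete surfaces. A CF-order is a countable poset with all $\theta_X(h)$ finite. A CF-order $X$ is a (discrete) $(-1)$-surface if $X=\emptyset$; a (discrete) $0$-surface if $X=\{x,y\}$ with $x\neq y$ and $x\notin\theta^{\square}_X(y)$; and, for $k\ge1$, a (discrete) $k$-surface if it is non-empty, connected and $|\theta^{\square}_X(h)|$ is a $(k-1)$-surface for every $h\in X$. Border and PCM's. The border of a poset $X$ of rank $n\ge0$ is $\Delta X=\{h\in X: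 |\theta^{\square}_X(h)| \text{ is not an } (n-1)\text{-surface}\}$. A poset $X$ of rank $n\ge -1$ is an $n$-PCM ($n$-dimensional poset-based connected manifold) if: $n=-1$ and $X=\emptyset$; or $n=0$ and $X$ is a singleton; or $n\ge1$, $X$ is connected, $\Delta X\ne\emptyset$, and for every $h\in X$, $|\theta^{\square}_X(h)|$ is either an $(n-1)$-surface (and $h\notin\Delta X$) or an $(n-1)$-PCM (and $h\in\Delta X$). Simplicial complexes. A simplex is a non-empty finite set $h$, of dimension $\dim(h)=\#h-1$. A simplicial complex is a finite set of simplices containing every non-empty subset of each of its elements (hence also every non-empty intersection of two of its elements); it is viewed as a poset ordered by inclusion, so that rank equals dimension. The link of $h\in X$ is $\mathrm{lk}(h,X)=\{h'\in X: h\cap h'=\emptyset,\ h\cup h'\in X\}$. Pseudomanifolds. A simplicial complex $X$ of rank $n\ge 0$ is a pseudomanifold if either $n=0$ and $X$ consists of one single element, or $n\ge1$ and: $X$ is pure, that is, every $h\in X$ is contained in an $n$-face of $X$; each $(n-1)$-face of $X$ is a face of one or two $n$-faces of $X$; and any two $n$-faces of $X$ are joined by a path consisting only of $(n-1)$-faces and $n$-faces of $X$. A pseudomanifold $X$ of rank $n\ge 0$ is normal if the link in $X$ of every face of dimension $d\le n-2$ is a pseudomanifold.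
   Formalization: For n = 0 the claim as written fails (a single point has ΔX = ∅ but is not a 0-surface), so the second alternative requires ΔX ≠ ∅ only when n ≥ 1; for n = 0 the conclusion is that X is a 0-PCM. *)

(* Defs.v *)
From HB Require Import structures.
From mathcomp Require Import all_boot all_order all_algebra.
From mathcomp Require Import boolp classical_sets functions cardinality.

Set Implicit Arguments.
Unset Strict Implicit.
Unset Printing Implicit Defensive.

Import Order.TTheory GRing.Theory Num.Theory.
Export Order.DefaultSetSubsetOrder.

Local Open Scope classical_set_scope.
Local Open Scope ring_scope.

(* A poset is given as a subset [S] of an ambient [porderType T], with the
   induced order; [|A|] for [A `<=` S] is then just [A] itself. *)
Section Posets.
Context {disp : Order.disp_t} {T : porderType disp}.
Implicit Types (S : set T) (h x y : T) (k : int).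

Definition alpha S h : set T := [set x | S x /\ (x <= h)%O].
Definition beta S h : set T := [set x | S x /\ (h <= x)%O].
Definition theta S h : set T := alpha S h `|` beta S h.

Definition alpha0 S h : set T := alpha S h `\ h.
Definition theta0 S h : set T := theta S h `\ h.

(* [elt_rank S h k] says that [h] is an element of [S] of rank [k], i.e. a
   [k]-face of [S]; it is a relation because an element of an arbitrary poset
   need not have a finite rank.  In the second rule, [m] is the maximum of the
   ranks [r x] of the [x] in [alpha0 S h]. *)
Inductive elt_rank S : T -> nat -> Prop :=
| elt_rank0 h : S h -> alpha0 S h = set0 -> elt_rank S h 0
| elt_rankS h (r : T -> nat) (m : nat) :
    S h ->
    (forall x, alpha0 S h x -> elt_rank S x (r x)) ->
    (forall x, alpha0 S h x -> (r x <= m)%N) ->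
    (exists2 x, alpha0 S h x & r x = m) ->
    elt_rank S h m.+1.

Definition poset_rank S k : Prop :=
  (k = -1 /\ S = set0) \/
  exists n : nat,
    [/\ k = n%:Z,
        forall h, S h -> exists2 i : nat, (i <= n)%N & elt_rank S h i
      & exists h, elt_rank S h n].

Definition is_path S x (p : seq T) : Prop :=
  S x /\ path (fun a b => b \in theta0 S a) x p.

Definition poset_connected S : Prop :=
  forall x y, S x -> S y -> exists2 p, is_path S x p & last x p = y.

Definition CF_order S : Prop :=
  countable S /\ forall h, S h -> finite_set (theta S h).

Inductive surface : int -> set T -> Prop :=
| surface_m1 S : CF_order S -> S = set0 -> surface (-1) S
| surface_0 S : CF_order S ->
    (exists x y, [/\ S = [set x; y], x <> y & ~ theta0 S y x]) ->
    surface 0 S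
| surface_pos k S : 1 <= k -> CF_order S ->
    S !=set0 -> poset_connected S ->
    (forall h, S h -> surface (k - 1) (theta0 S h)) ->
    surface k S.

(* The rank of [S] is unique when it exists, so [n] below is determined by
   [S].  If [S] has rank 0 then [theta0 S h] is empty, i.e. a (-1)-surface, for
   every [h], so the border is empty, even when [S] is a singleton. *)
Definition border S : set T :=
  [set h | S h /\
     exists2 n : nat, poset_rank S n%:Z & ~ surface (n%:Z - 1) (theta0 S h)].

Inductive PCM : int -> set T -> Prop :=
| PCM_m1 S : poset_rank S (-1) -> S = set0 -> PCM (-1) S
| PCM_0 S : poset_rank S 0 -> (exists x, S = [set x]) -> PCM 0 S
| PCM_pos k S : 1 <= k -> poset_rank S k ->
    poset_connected S -> border S !=set0 ->
    (forall h, S h ->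
       (surface (k - 1) (theta0 S h) /\ ~ border S h) \/
       (PCM (k - 1) (theta0 S h) /\ border S h)) ->
    PCM k S.

End Posets.

Section Complexes.
Context {V : finType}.
Implicit Types (X : {set {set V}}) (h g : {set V}) (n k : nat).

Definition simplicial_complex X : Prop :=
  finset.set0 \notin X /\
  forall h g, h \in X -> g \subset h -> g != finset.set0 -> g \in X.

(* [DefaultSetSubsetOrder] orders [{set V}] by inclusion. *)
Definition face_poset X : set {set V} := [set h | h \in X].

Definition face X k h : Prop := elt_rank (face_poset X) h k.

Definition faces X k : {set {set V}} := finset (fun h => `[< face X k h >]).

Definition simplex_dim h : int := #|h|%:Z - 1.

Definition link h X : {set {set V}} :=
  finset (fun g => [&& g \in X, h :&: g == finset.set0 & h :|: g \in X]).

Definition pseudomanifold n X : Prop :=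
  [/\ simplicial_complex X, poset_rank (face_poset X) n%:Z &
      (n = 0%N /\ exists x, X = [set x]%SET) \/
      [/\ (1 <= n)%N,
          forall h, h \in X -> exists2 g, g \in faces X n & h \subset g,
          forall h, h \in faces X n.-1 ->
            let c := #|finset (fun g => (g \in faces X n) && (h \subset g))| in
            c = 1%N \/ c = 2%N
        & forall g g', g \in faces X n -> g' \in faces X n ->
            exists p : seq {set V},
              [/\ is_path (face_poset X) g p,
                  last g p = g'
                & forall f, f \in g :: p ->
                    f \in faces X n.-1 \/ f \in faces X n]]].

Definition normal_pseudomanifold n X : Prop :=
  pseudomanifold n X /\
  forall h, h \in X -> simplex_dim h <= n%:Z - 2 ->
    exists m : nat, pseudomanifold m (link h X).

End Complexes.

(* Main.v *)
Require Import Defs.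
From mathcomp Require Import all_boot all_order all_algebra.
From mathcomp Require Import boolp classical_sets functions cardinality.
From mathcomp Require Import zify.

(** A complex [X] is locally a join: the elements comparable with a face [x] are
    the proper faces of [x], which form the boundary of a simplex, and the
    proper cofaces of [x], which form a copy of the link of [x]; every element
    of the first kind lies below every element of the second.  A sphere joined
    with a sphere is a sphere, and a sphere joined with a ball is a ball; so if
    links of faces are surfaces or PCM's, all the neighbourhoods
    [theta0 X x] are surfaces or PCM's.

    The proof is freed from deciding which case occurs.  The predicate
    [manifold k S] asks, recursively, that [S] be connected with manifolds as
    neighbourhoods, and in rank 0 that it have one or two points.  It is stable
    under joins ([manifold_join]), and it implies being a surface or a PCM
    ([manifold_surface_or_PCM]): [S] is a surface when all its neighbourhoods
    are, and otherwise the remaining points form a non-empty border.  The rank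
    required of a PCM is computed from longest chains ([poset_rankP]).

    To avoid transport along the isomorphism between a link and a set of
    cofaces, the induction runs on the sets [cofaces X h] of faces of [X]
    strictly containing [h], by decreasing dimension of [h]
    ([manifold_cofaces]).  Inside [cofaces X h] the neighbourhood of [x] is the
    join of the open interval between [h] and [x], which is the boundary of a
    simplex ([manifold_interval]), with [cofaces X x], known by induction.  The
    rest is what the hypotheses give directly: an [(n-1)]-face lies in one or
    two [n]-faces, and the links of smaller faces are connected because they
    are pseudomanifolds.  For [0 < n] the theorem is the case where [h] is
    empty; for [n = 0], [X] is a single point, a 0-PCM. *)

Set Implicit Arguments.
Unset Strict Implicit.
Unset Printing Implicit Defensive.

Import Order.TTheory GRing.Theory Num.Theory.

(** * Rank and longest chains in a finite poset *)

Section FinitePosets.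
Local Open Scope classical_set_scope.
Context {disp : Order.disp_t} {T : finPOrderType disp}.
Implicit Types (S A B : set T) (C : {set T}) (h x y z : T) (k m n : nat).

Definition chain C : Prop :=
  forall x y, x \in C -> y \in C -> (x <= y)%O \/ (y <= x)%O.

Definition chain_in S C : Prop := chain C /\ forall x, x \in C -> S x.

(** Numbering by the number of elements of a longest chain, which is the rank
    plus one, keeps the empty poset, of rank [-1], inside [nat]. *)
Definition chain_rank S k : Prop :=
  (exists2 C, chain_in S C & #|C| = k) /\
  forall C, chain_in S C -> (#|C| <= k)%N.

Lemma chain_rank_inj S k m : chain_rank S k -> chain_rank S m -> k = m.
Proof.
move=> [[C SC <-] Ck] [[D SD <-] Dm].
by apply/eqP; rewrite eqn_leq Dm //= Ck.
Qed.

Lemma chain_in_sub S C (D : {set T}) :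
  chain_in S C -> D \subset C -> chain_in S D.
Proof.
move=> [cC SC] /fintype.subsetP DC; split=> [x y /DC xC /DC yC|x /DC].
  exact: cC.
exact: SC.
Qed.

(** How chains grow: [h] is added to a chain of [theta0 S h], or on top of a
    chain of [alpha0 S h]. *)
Lemma chain_in_setU1 S C h : chain_in S C -> S h ->
  (forall x, x \in C -> (x <= h)%O \/ (h <= x)%O) -> chain_in S (h |: C).
Proof.
move=> [cC SC] Sh Ch; split=> [x y|x]; rewrite !inE.
  move=> /predU1P[->|xC] /predU1P[->|yC]; [by left| |exact: Ch|exact: cC].
  by case: (Ch _ yC); [right|left].
by move=> /predU1P[->//|/SC].
Qed.

Lemma chain_max C x0 : chain C -> x0 \in C ->
  exists2 h, h \in C & forall x, x \in C -> (x <= h)%O.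
Proof.
move=> cC Cx0.
case: (@arg_maxnP _ x0 (mem C) (fun x => #|[set y in C | (y <= x)%O]%SET|) Cx0).
move=> h hC hmax; exists h => // x xC.
case: (cC x h xC hC) => // hx.
have sub : ([set y in C | (y <= h)%O] \subset [set y in C | (y <= x)%O])%SET.
  by apply/fintype.subsetP => y; rewrite !inE => /andP[-> /le_trans->].
have /eqP/setP/(_ x) :
    ([set y in C | (y <= h)%O] == [set y in C | (y <= x)%O])%SET.
  by rewrite eqEcard sub; exact: hmax.
by rewrite !inE xC lexx.
Qed.

Lemma theta0E S h x :
  theta0 S h x <-> [/\ S x, x <> h & (x <= h)%O \/ (h <= x)%O].
Proof.
split=> [[[[Sx xh]|[Sx hx]] nxh]|[Sx nxh [xh|hx]]].
- by split=> //; left.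
- by split=> //; right.
- by split=> //; left.
- by split=> //; right.
Qed.

Lemma alpha0E S h x : alpha0 S h x <-> S x /\ (x < h)%O.
Proof.
rewrite lt_neqAle; split=> [[[Sx xh] /eqP nxh]|[Sx /andP[/eqP nxh xh]]].
  by rewrite nxh xh.
by split.
Qed.

(** Each rule of [elt_rank] adds [h] on top of a longest chain among those that
    end strictly below [h], so the rank of [h] counts the steps of a longest
    chain with top [h]. *)
Lemma elt_rank_chain S h n : elt_rank S h n ->
  (exists2 C, chain_in S C /\ h \in C &
     (forall x, x \in C -> (x <= h)%O) /\ #|C| = n.+1) /\
  forall C, chain_in S C -> h \in C -> (forall x, x \in C -> (x <= h)%O) ->
   (#|C| <= n.+1)%N.
Proof.
elim=> {h n}[h Sh h0|h r m Sh _ IH rm [x hx rxm]].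
  split.
    exists [set h]%SET; last first.
      by split; [move=> x /set1P->|rewrite cards1].
    split; last exact: set11.
    by split=> [x y /set1P-> /set1P->|x /set1P-> //]; left.
  move=> C [_ SC] hC Ch.
  rewrite (_ : C = [set h]%SET) ?cards1 //.
  apply/setP => x; rewrite inE; apply/idP/eqP => [xC|-> //].
  apply/eqP/negPn/negP => /negP nxh.
  have : alpha0 S h x.
    apply/alpha0E; rewrite lt_neqAle Ch // andbT.
    by split=> //; [exact: SC|apply/negP].
  by rewrite h0.
split.
  have [[C [SC xC] [Cx Cm]] _] := IH x hx.
  have [Sx xh] : S x /\ (x < h)%O by apply/alpha0E.
  have Ch y : y \in C -> (y <= h)%O by move=> /Cx /le_trans; apply; exact: ltW.
  exists (h |: C)%SET; split.
  - by apply: chain_in_setU1 => // y /Ch; left.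
  - exact: setU11.
  - by move=> y; rewrite !inE => /predU1P[->|/Ch].
  - rewrite cardsU1 Cm rxm (_ : h \notin C) //.
    by apply/negP => /Cx; rewrite (lt_geF xh).
move=> C SC hC Ch; rewrite (cardsD1 h) hC /= add1n ltnS.
have SD : chain_in S (C :\ h)%SET by apply: chain_in_sub SC _; exact: subD1set.
have [->|[z zD]] := set_0Vmem (C :\ h)%SET; first by rewrite cards0.
have [y yD Dy] := chain_max SD.1 zD.
have hy : alpha0 S h y.
  apply/alpha0E; split; first exact: SD.2.
  by move: yD; rewrite !inE lt_neqAle => /andP[-> /Ch].
apply: (@leq_trans (r y).+1); last exact: rm.
exact: (IH _ hy).2.
Qed.

Lemma elt_rank_inj S h m n : elt_rank S h m -> elt_rank S h n -> m = n.
Proof.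
move=> /elt_rank_chain[[C [SC hC] [Ch Cm]] maxm].
move=> /elt_rank_chain[[D [SD hD] [Dh Dn]] maxn].
apply: succn_inj; apply/eqP; rewrite eqn_leq -{1}Cm -{2}Dn.
by rewrite maxn // maxm.
Qed.

Lemma elt_rank_exists S h : S h -> exists n, elt_rank S h n.
Proof.
have [N] := ubnP #|[set x | (x < h)%O]%SET|.
elim: N h => // N IH h; rewrite ltnS => hN Sh.
have [h0|/set0P[x0 hx0]] := eqVneq (alpha0 S h) set0.
  by exists 0%N; constructor.
have IH' x : alpha0 S h x -> exists n, elt_rank S x n.
  move=> /alpha0E[Sx xh]; apply: IH => //.
  apply: leq_trans hN; apply: proper_card; apply/fintype.properP.
  split; first by apply/fintype.subsetP => y; rewrite !inE => /lt_trans; apply.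
  by exists x; rewrite !inE ?ltxx.
have /choice[r rP] : forall x, exists n, alpha0 S h x -> elt_rank S x n.
  move=> x; have [/IH'[n ?]|nx] := pselect (alpha0 S h x); first by exists n.
  by exists 0%N.
have x0P : x0 \in [set x | `[< alpha0 S h x >]]%SET.
  by rewrite inE; apply/asboolP.
case: (@arg_maxnP _ x0 (mem [set x | `[< alpha0 S h x >]]%SET) r x0P) => x.
rewrite /= inE => /asboolP hx xmax.
exists (r x).+1; apply: (elt_rankS (r := r)) => //; last by exists x.
by move=> y hy; apply: xmax; rewrite inE; apply/asboolP.
Qed.

(** The recursive rank is the length of a longest chain.  Chains make the rank
    visibly unique, and computable from the subposets [theta0 S h]. *)
Lemma poset_rankP S (r : int) :
  poset_rank S r <-> exists2 k : nat, r = (k%:Z - 1)%R & chain_rank S k.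
Proof.
split.
  move=> [[-> ->]|[n [-> Sn [h hn]]]].
    exists 0%N => //; split.
      by exists finset.set0; rewrite ?cards0 //; split=> x; rewrite inE.
    move=> C [_ C0]; rewrite leqn0 cards_eq0; apply/eqP/setP => x.
    by rewrite inE; apply/negP => /C0.
  exists n.+1; first lia.
  split; first by have [[C [SC _] [_ Cn]] _] := elt_rank_chain hn; exists C.
  move=> C SC; have [->|[z zC]] := set_0Vmem C; first by rewrite cards0.
  have [x xC Cx] := chain_max SC.1 zC.
  have [i ni xi] := Sn _ (SC.2 _ xC).
  exact: leq_trans ((elt_rank_chain xi).2 _ SC xC Cx) _.
move=> [[|k] -> [[C SC Ck] maxC]].
  left; split=> //; apply/seteqP; split=> // x Sx.
  have : chain_in S [set x]%SET.
    by split=> [y z /set1P-> /set1P->|y /set1P-> //]; left.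
  by move/maxC; rewrite cards1.
right; exists k; split; first lia.
  move=> h Sh; have [i hi] := elt_rank_exists Sh; exists i => //.
  have [[D [SD _] [_ Di]] _] := elt_rank_chain hi.
  by rewrite -ltnS -Di maxC.
have [C0|[z zC]] := set_0Vmem C; first by move: Ck; rewrite C0 cards0.
have [h hC Ch] := chain_max SC.1 zC.
exists h; have [i hi] := elt_rank_exists (SC.2 _ hC).
suff -> : k = i by [].
have [[D [SD _] [_ Di]] maxh] := elt_rank_chain hi.
have := maxh _ SC hC Ch; have := maxC _ SD.
by rewrite Di Ck !ltnS => ik ki; apply/eqP; rewrite eqn_leq ik ki.
Qed.

Lemma poset_rank_inj S (r s : int) : poset_rank S r -> poset_rank S s -> r = s.
Proof.
by move=> /poset_rankP[k -> kS] /poset_rankP[m -> /(chain_rank_inj kS)->].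
Qed.

(** Removing one of its elements [h] turns a chain of [S] into a chain of
    [theta0 S h], and conversely [h] is comparable with all of [theta0 S h]. *)
Lemma chain_rank_theta0 S k : S !=set0 ->
  (forall h, S h -> chain_rank (theta0 S h) k) -> chain_rank S k.+1.
Proof.
move=> [h Sh] thS; split.
  have [[C [cC hC] Ck] _] := thS h Sh.
  have SC x : x \in C -> S x by move=> /hC/theta0E[].
  exists (h |: C)%SET; first by apply: chain_in_setU1 => // x /hC/theta0E[].
  by rewrite cardsU1 Ck (_ : h \notin C) //; apply/negP => /hC/theta0E[].
move=> C SC; have [->|[x xC]] := set_0Vmem C; first by rewrite cards0.
rewrite (cardsD1 x) xC add1n ltnS; apply: (thS _ (SC.2 _ xC)).2.
split=> [|y].
  exact: (chain_in_sub SC (subD1set _ _)).1.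
rewrite !inE => /andP[/eqP yx yC]; apply/theta0E; split=> //; first exact: SC.2.
exact: SC.1.
Qed.

End FinitePosets.

(** * Connected posets *)

Section Connectedness.
Local Open Scope classical_set_scope.
Context {disp : Order.disp_t} {T : finPOrderType disp}.
Implicit Types (S : set T) (x y z : T).

(** [poset_connected S] says that any two elements of [S] are linked; unlike a
    single path, this relation composes without care for repeated points. *)
Definition linked S x y : Prop := exists2 p, is_path S x p & last x p = y.

Lemma linked_refl S x : S x -> linked S x x.
Proof. by move=> Sx; exists [::]. Qed.

Lemma linked_trans S y x z : linked S x y -> linked S y z -> linked S x z.
Proof.
move=> [p [Sx xp] <-] [q [_ pq] <-]; exists (p ++ q); last by rewrite last_cat.
by split=> //; rewrite cat_path xp.
Qed.

Lemma linked_comparable S x y : S x -> S y -> (x <= y)%O \/ (y <= x)%O ->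
  linked S x y.
Proof.
move=> Sx Sy xy; have [<-|/eqP nyx] := eqVneq y x; first exact: linked_refl.
exists [:: y] => //; split=> //=; rewrite andbT inE; apply/theta0E; split=> //.
by case: xy; [right|left].
Qed.

End Connectedness.

Lemma linked_hom (disp disp' : Order.disp_t) (T : finPOrderType disp)
    (T' : finPOrderType disp') (f : T -> T') (S : set T) (S' : set T') x y :
  {homo f : a b / (a <= b)%O} -> (forall a, S a -> S' (f a)) ->
  linked S x y -> linked S' (f x) (f y).
Proof.
move=> fle fS [p [Sx]]; elim: p x Sx => [|z p IH] x Sx /=.
  by move=> _ <-; apply/linked_refl/fS.
case/andP; rewrite inE => /theta0E[Sz _ xz] zp pe.
apply: linked_trans (IH _ Sz zp pe).
by apply: linked_comparable; [exact: fS|exact: fS|case: xz => /fle; auto].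
Qed.

(** * Surfaces and PCM's taken together *)

Section Manifolds.
Local Open Scope classical_set_scope.
Context {disp : Order.disp_t} {T : finPOrderType disp}.
Implicit Types (S A B : set T) (C : {set T}) (h x y z : T) (k m n : nat).

(** Connected posets that are locally manifolds, with no distinction between
    surfaces and PCM's and no mention of borders: which of the two occurs is
    read off at the end, in [manifold_surface_or_PCM].  The index is the rank
    plus one.  In rank 0, one point (the case [x = y]) stands for the 0-PCM and
    two points, incomparable because each [theta0 S h] is empty, for the
    0-surface. *)
Fixpoint manifold k S : Prop :=
  if k is k'.+1 then
    [/\ S !=set0, forall h, S h -> manifold k' (theta0 S h)
      & if k' is 0 then exists x y, S = [set x; y] else poset_connected S]
  else S = set0.

(** The order join of two manifolds is a manifold, as for spheres and balls in
    topology: the neighbourhood of [a] in the join is the join of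
    [theta0 A a] with [B], and symmetrically for [b] in [B], so an induction on
    the ranks applies.  When [A] and [B] are both non-empty, the join is
    connected because every point of [A] lies below every point of [B]. *)
Lemma manifold_join p q A B : manifold p A -> manifold q B ->
  (forall a b, A a -> B b -> (a < b)%O) -> manifold (p + q) (A `|` B).
Proof.
have [N] := ubnP (p + q); elim: N p q A B => // N IH [|p] q A B.
  by move=> _ -> mB _; rewrite add0n set0U.
case: q => [|q]; first by move=> _ mA -> _; rewrite addn0 setU0.
rewrite ltnS => pqN mA mB AB.
have [[a0 Aa0] thA _] := mA; have [[b0 Bb0] thB _] := mB.
rewrite addSn addnS; split; first by exists a0; left.
  move=> h [Ah|Bh].
    have -> : theta0 (A `|` B) h = theta0 A h `|` B.
      apply/seteqP; split=> x.
        move=> /theta0E[[Ax|Bx] xh c]; last by right.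
        by left; apply/theta0E.
      move=> [/theta0E[Ax xh c]|Bx]; apply/theta0E; first by split=> //; left.
      have hx := AB _ _ Ah Bx; split; [by right| |by right; apply: ltW].
      by move=> xh; rewrite xh ltxx in hx.
    rewrite -addnS; apply: IH => //.
      exact: thA.
    by move=> a b /theta0E[Aa _ _]; apply: AB.
  have -> : theta0 (A `|` B) h = A `|` theta0 B h.
    apply/seteqP; split=> x.
      move=> /theta0E[[Ax|Bx] xh c]; first by left.
      by right; apply/theta0E.
    move=> [Ax|/theta0E[Bx xh c]]; apply/theta0E; last by split=> //; right.
    have hx := AB _ _ Ax Bh; split; [by left| |by left; apply: ltW].
    by move=> xh; rewrite xh ltxx in hx.
  rewrite -addSn; apply: IH => //; first lia.
    exact: thB.
  by move=> a b Aa /theta0E[Bb _ _]; apply: AB.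
have AA x y : A x -> A y -> linked (A `|` B) x y.
  move=> Ax Ay; apply: (linked_trans (y := b0)); apply: linked_comparable.
  - by left.
  - by right.
  - by left; apply: ltW; apply: AB.
  - by right.
  - by left.
  - by right; apply: ltW; apply: AB.
have ABl x y : A x -> B y -> linked (A `|` B) x y.
  move=> Ax By; apply: linked_comparable; [by left|by right|].
  by left; apply: ltW; apply: AB.
have BA x y : B x -> A y -> linked (A `|` B) x y.
  move=> Bx Ay; apply: linked_comparable; [by right|by left|].
  by right; apply: ltW; apply: AB.
move=> x y [Ax|Bx] [Ay|By]; [exact: AA|exact: ABl|exact: BA|].
exact: linked_trans (BA _ _ Bx Aa0) (ABl _ _ Aa0 By).
Qed.

Lemma chain_rank_manifold k S : manifold k S -> chain_rank S k.
Proof.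
elim: k S => [|k IH] S /=.
  move=> ->; split.
    by exists finset.set0; rewrite ?cards0 //; split=> x; rewrite inE.
  move=> C [_ C0]; rewrite leqn0 cards_eq0; apply/eqP/setP => x.
  by rewrite inE; apply/negP => /C0.
by move=> [S0 thS _]; apply: chain_rank_theta0 => // h /thS/IH.
Qed.

Lemma poset_rank_manifold k S : manifold k.+1 S -> poset_rank S k%:Z.
Proof.
by move=> /chain_rank_manifold kS; apply/poset_rankP; exists k.+1 => //; lia.
Qed.

Lemma CF_order_finite S : CF_order S.
Proof.
split=> [|h _]; last exact: finite_finset.
exact/finite_set_countable/finite_finset.
Qed.

(** A neighbourhood that is not a surface is a PCM by induction, and its centre
    then belongs to the border by definition.  So either all neighbourhoods are
    surfaces, or the border is non-empty. *)
Lemma manifold_surface_or_PCM k S : manifold k S ->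
  surface (k%:Z - 1)%R S \/ PCM (k%:Z - 1)%R S.
Proof.
elim: k S => [S S0|k IH S mS].
  by left; apply: surface_m1 => //; exact: CF_order_finite.
have rS := poset_rank_manifold mS.
rewrite (_ : k.+1%:Z - 1 = k%:Z)%R; last lia.
case: k IH mS rS => [|k] IH mS rS; case: (mS) => S0 thS.
  move=> [x [y Sxy]]; have [xy|/eqP nxy] := eqVneq x y.
    by right; apply: PCM_0 => //; exists y; rewrite Sxy xy setUid.
  left; apply: surface_0; first exact: CF_order_finite.
  exists x, y; split=> // yx.
  have Sy : S y by rewrite Sxy; right.
  by have /= th0 := thS _ Sy; rewrite th0 in yx.
move=> conS.
have [surfS|nsurfS] := pselect (forall h, S h ->
    surface (k.+1%:Z - 1)%R (theta0 S h)).
  by left; apply: surface_pos => //; exact: CF_order_finite.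
right; apply: PCM_pos => //.
  apply: contrapT => nb; apply: nsurfS => h Sh; apply: contrapT => nsh.
  by apply: nb; exists h; split=> //; exists k.+1.
move=> h Sh; have [sh|nsh] := pselect (surface (k.+1%:Z - 1)%R (theta0 S h)).
  by left; split=> // -[_ [m /(poset_rank_inj rS)<-]].
right; split; last by split=> //; exists k.+1.
by case: (IH _ (thS _ Sh)).
Qed.

Lemma surface_theta0 (r : int) S h : (1 <= r)%R -> surface r S -> S h ->
  surface (r - 1)%R (theta0 S h).
Proof. by move=> r1 sS; case: sS r1 => // *; auto. Qed.

Lemma surface_border0 n S : (0 < n)%N -> poset_rank S n%:Z -> surface n%:Z S ->
  border S = set0.
Proof.
move=> n_gt0 rS sS; apply/seteqP; split=> // h [Sh [m /(poset_rank_inj rS)<-]].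
by apply; apply: surface_theta0.
Qed.

Lemma PCM_border (r : int) S : (1 <= r)%R -> PCM r S -> border S !=set0.
Proof. by move=> r1 pS; case: pS r1. Qed.

End Manifolds.

(** * Faces, intervals and cofaces in a simplicial complex *)

Section Complexes.
Import boot.fintype boot.finset.
Local Open Scope classical_set_scope.
Context {V : finType}.
Implicit Types (X L : {set {set V}}) (g h x y : {set V}) (k m n : nat).

Lemma leset x y : (x <= y)%O = (x \subset y).
Proof. exact: Order.SetSubsetOrder.leEsubset. Qed.
Lemma ltset x y : (x < y)%O = (x \proper y).
Proof. by rewrite lt_neqAle leset properEneq. Qed.

Lemma simplex_neq0 X h : simplicial_complex X -> h \in X -> h != finset.set0.
Proof. by move=> [X0 _]; apply: contraTneq => ->. Qed.

(** The proper faces of a simplex are its proper non-empty subsets, of smaller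
    cardinal by one when a single vertex is removed: rank is dimension. *)
Lemma elt_rank_face X h : simplicial_complex X -> h \in X ->
  elt_rank (face_poset X) h #|h|.-1.
Proof.
move=> cX; have [N] := ubnP #|h|; elim: N h => // N IH h.
rewrite ltnS => hN hX; have /set0Pn[v hv] := simplex_neq0 cX hX.
have hE : #|h| = #|(h :\ v)%SET|.+1 by rewrite (cardsD1 v) hv.
have [h1|h1] := eqVneq (h :\ v)%SET finset.set0.
  rewrite hE h1 cards0; constructor=> //.
  apply/seteqP; split=> // x /alpha0E[xX].
  rewrite ltset => /proper_card; rewrite hE h1 cards0 ltnS leqn0 cards_eq0.
  by rewrite (negPf (simplex_neq0 cX xX)).
rewrite hE /=; rewrite -card_gt0 in h1; rewrite -(prednK h1).
(* The rank of [h] is attained on a facet [h :\ v]. *)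
have hvh : (h :\ v \proper h)%SET by rewrite properD1.
apply: (elt_rankS (r := fun x => #|x|.-1)) => //.
- move=> x /alpha0E[xX]; rewrite ltset => /proper_card xh.
  by apply: IH => //; lia.
- by move=> x /alpha0E[xX]; rewrite ltset => /proper_card xh; lia.
- exists (h :\ v)%SET => //; apply/alpha0E; rewrite ltset; split=> //.
  apply: cX.2 hX (proper_sub hvh) _; first by rewrite -card_gt0.
Qed.

Lemma faceP X k h : simplicial_complex X ->
  h \in faces X k <-> h \in X /\ #|h| = k.+1.
Proof.
move=> cX; rewrite inE; split=> [/asboolP hk|[hX hk]].
  have hX : h \in X by case: hk.
  split=> //; rewrite (elt_rank_inj hk (elt_rank_face cX hX)) prednK //.
  by rewrite card_gt0 (simplex_neq0 cX hX).
by apply/asboolP; have := elt_rank_face cX hX; rewrite hk.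
Qed.

(** By purity every face is comparable with a face of maximal dimension, and
    these are joined by paths. *)
Lemma pseudomanifold_connected m L : pseudomanifold m L ->
  poset_connected (face_poset L).
Proof.
move=> [cL _ [[_ [a ->]]|[_ pure _ strong]]] x y.
  by move=> /set1P-> /set1P->; apply: linked_refl; apply: set11.
move=> xL yL; have [g gL xg] := pure x xL; have [g' gL' yg'] := pure y yL.
have [p [gp pg' _]] := strong g g' gL gL'.
have [gX _] := (faceP m g cL).1 gL; have [gX' _] := (faceP m g' cL).1 gL'.
apply: (linked_trans (y := g)); first by apply: linked_comparable; auto.
apply: (linked_trans (y := g')); first by exists p.
by apply: linked_comparable; auto.
Qed.

(** The open interval between [h] and [g]; for [h] empty it is the boundary of
    the simplex [g]. *)
Definition interval h g : set {set V} := [set x | h \proper x /\ x \proper g].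

(** As a poset, this is a copy of [link h X], by [x |-> x :\: h].  Working above
    [h] inside [X] avoids transporting surfaces and PCM's along that
    isomorphism.  For [h] empty, it is the whole of [X]. *)
Definition cofaces X h : set {set V} := [set g | g \in X /\ h \proper g].

Lemma theta0_interval h g x : interval h g x ->
  theta0 (interval h g) x = interval h x `|` interval x g.
Proof.
move=> [hx xg]; apply/seteqP; split=> y.
  move=> /theta0E[[hy yg] /eqP nyx [yx|xy]]; [left|right]; split=> //.
    by rewrite properEneq nyx.
  by rewrite properEneq eq_sym nyx.
move=> [[hy yx]|[xy yg]]; apply/theta0E.
  split; [split=> //; exact: proper_trans xg| |left; exact: proper_sub].
  by move=> yx'; rewrite yx' properxx in yx.
split; [split=> //; exact: proper_trans xy| |right; exact: proper_sub].
by move=> yx'; rewrite yx' properxx in xy.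
Qed.

(** Below [x] the complex contains every face, above [x] it contains the
    cofaces, and the former are all smaller than the latter: the neighbourhood
    of [x] is the join of an interval, combinatorially a sphere, and of the
    cofaces of [x]. *)
Lemma theta0_cofaces X h x : simplicial_complex X -> cofaces X h x ->
  theta0 (cofaces X h) x = interval h x `|` cofaces X x.
Proof.
move=> cX [xX hx]; apply/seteqP; split=> y.
  move=> /theta0E[[yX hy] /eqP nyx [yx|xy]]; [left|right]; split=> //.
    by rewrite properEneq nyx.
  by rewrite properEneq eq_sym nyx.
move=> [[hy yx]|[yX xy]]; apply/theta0E.
  split; [split=> //|by move=> yx'; rewrite yx' properxx in yx|].
    apply: cX.2 xX (proper_sub yx) _.
    by apply: contraTneq hy => ->; rewrite properE sub0set andbF.
  by left; apply: proper_sub.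
split; [split=> //; exact: proper_trans xy| |right; exact: proper_sub].
by move=> yx'; rewrite yx' properxx in xy.
Qed.

(** The interval is the boundary of the simplex on the vertex set [g :\: h].
    Its neighbourhoods are joins of two shorter intervals. *)
Lemma manifold_interval h g : h \proper g ->
  manifold (#|g| - #|h|).-1 (interval h g).
Proof.
have [N] := ubnP (#|g| - #|h|); elim: N h g => // N IH h g.
rewrite ltnS => ghN hg; have hgc := proper_card hg.
have thI x : interval h g x ->
    manifold (#|g| - #|h|).-2 (theta0 (interval h g) x).
  move=> xI; rewrite theta0_interval //; have [hx xg] := xI.
  have hxc := proper_card hx; have xgc := proper_card xg.
  rewrite (_ : _.-2 = (#|x| - #|h|).-1 + (#|g| - #|x|).-1); last lia.
  apply: manifold_join; [apply: IH => //; lia|apply: IH => //; lia|].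
  by move=> a b [_ ax] [xb _]; rewrite ltset; apply: proper_trans xb.
have addI v : v \in g -> v \notin h -> (2 <= #|g| - #|h|)%N ->
    interval h g (v |: h).
  move=> vg vh gh2; split; first by rewrite properUr ?sub1set.
  rewrite properEcard subUset sub1set vg proper_sub //= cardsU1 vh; lia.
have ghE : #|g :\: h| = #|g| - #|h|.
  by rewrite cardsDS // proper_sub.
have [gh1|] := leqP (#|g| - #|h|) 1.
  rewrite (_ : _.-1 = 0); last lia.
  by apply/seteqP; split=> // x [/proper_card ? /proper_card ?]; lia.
move=> gh2; rewrite -(@prednK (_.-1)); last lia.
have [v vD] : exists v, v \in g :\: h.
  by apply/set0Pn; rewrite -card_gt0; lia.
have /andP[vh vg] : (v \notin h) && (v \in g) by rewrite -in_setD.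
split=> //; first by exists (v |: h); apply: addI.
(* With two vertices [a], [b] in [g :\: h], the interval consists of [a |: h]
   and [b |: h]. *)
have [gh|gh3] := leqP (#|g| - #|h|) 2.
  rewrite (_ : _.-2 = 0); last lia.
  have /eqP/cards2P[a [b [_ abE]]] : #|g :\: h| = 2 by lia.
  exists (a |: h), (b |: h); apply/seteqP; split=> x.
    move=> [hx xg].
    have /properP[_ [w wx wh]] := hx.
    have xE : x = w |: h.
      apply/eqP; rewrite eq_sym eqEcard subUset sub1set wx proper_sub //=.
      have := proper_card hx; have := proper_card xg.
      by rewrite cardsU1 wh; lia.
    have : w \in g :\: h.
      by rewrite in_setD wh (fintype.subsetP (proper_sub xg)).
    by rewrite abE => /set2P[] <-; [left|right].
  have : a \in g :\: h by rewrite abE set21.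
  have : b \in g :\: h by rewrite abE set22.
  by rewrite !in_setD => /andP[bh bg] /andP[ah ag] [|] ->; apply: addI.
case E : (_.-2) => [|k]; first lia.
(* With at least three vertices in [g :\: h], a vertex [a] of [x] and a vertex
   [b] of [y] give the path [x, a |: h, a |: (b |: h), b |: h, y]; its middle
   term is not the whole of [g]. *)
move=> x y [hx xg] [hy yg].
have /properP[_ [a ax ah]] := hx; have /properP[_ [b bY bh]] := hy.
have ag := fintype.subsetP (proper_sub xg) _ ax.
have bg := fintype.subsetP (proper_sub yg) _ bY.
have aI : interval h g (a |: h) by apply: addI.
have bI : interval h g (b |: h) by apply: addI.
have abI : interval h g (a |: (b |: h)).
  split.
    by apply: proper_sub_trans (subsetUr _ _); case: bI.
  rewrite properEcard !subUset !sub1set ag bg proper_sub //=.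
  move: gh3; rewrite !cardsU1; clear.
  by do 2!case: (_ \notin _); lia.
apply: (linked_trans (y := a |: h)).
  apply: linked_comparable => //; right.
  by rewrite leset subUset sub1set ax proper_sub.
apply: (linked_trans (y := (a |: (b |: h)))).
  apply: linked_comparable => //; left.
  by rewrite leset setUS // subsetUr.
apply: (linked_trans (y := b |: h)).
  by apply: linked_comparable => //; right; rewrite leset subsetUr.
apply: linked_comparable => //; left.
by rewrite leset subUset sub1set bY proper_sub.
Qed.

(** Taking the union with [h] maps paths of the link to paths above [h]. *)
Lemma cofaces_connected X h : simplicial_complex X -> h \in X ->
  poset_connected (face_poset (link h X)) -> poset_connected (cofaces X h).
Proof.
move=> cX hX conL.
have inL x : cofaces X h x ->
    face_poset (link h X) (x :\: h) /\ x = h :|: (x :\: h).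
  move=> [xX hx]; have xE : h :|: (x :\: h) = x.
    by rewrite setDE setUIr setUCr setIT; apply/setUidPr/proper_sub.
  split=> //; rewrite /face_poset /= inE xE xX andbT; apply/andP; split.
    apply: cX.2 xX (subsetDl _ _) _.
    by rewrite -card_gt0 cardsDS ?proper_sub // subn_gt0 proper_card.
  by apply/eqP; apply/setP=> v; rewrite !inE; case: (v \in h).
move=> x y /inL[xL ->] /inL[yL ->].
apply: (linked_hom (f := fun z => h :|: z)) (conL _ _ xL yL).
  by move=> a b; rewrite !leset; apply: setUS.
move=> a; rewrite /face_poset /= inE => /and3P[aX ha haX]; split=> //.
rewrite properEneq subsetUl andbT; apply: contraNneq (simplex_neq0 cX aX) => E.
by rewrite -(eqP ha) E setIC setKU.
Qed.

Lemma cofaces0 X : simplicial_complex X -> cofaces X finset.set0 = face_poset X.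
Proof.
move=> cX; apply/seteqP; split=> x; first by case.
by move=> xX; split=> //; rewrite proper0 (simplex_neq0 cX xX).
Qed.

(** Induction on the codimension of [h]: the neighbourhood of [x] above [h] is
    the join of an interval with the cofaces of [x], where [x] has smaller
    codimension.  The axioms of a normal pseudomanifold supply what is not
    local: an [(n-1)]-face has one or two cofaces, and faces of dimension at
    most [n-2] have a connected link. *)
Lemma manifold_cofaces n X h : (0 < n)%N -> normal_pseudomanifold n X ->
  h \in finset.set0 |: X -> manifold (n.+1 - #|h|) (cofaces X h).
Proof.
move=> n0 [pX nX] h0X;
have [cX rX [[n0' _]|[_ pure two _]]] := pX; first lia.
have faceX := faceP _ _ cX.
have cardX x : x \in X -> (#|x| <= n.+1)%N.
  by move=> /pure[g /faceX[gX <-]]; apply: subset_leq_card.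
have [N] := ubnP (n.+1 - #|h|); elim: N h h0X => // N IH h h0X.
rewrite ltnS => hN.
have th x : cofaces X h x -> manifold (n.+1 - #|h|).-1 (theta0 (cofaces X h) x).
  move=> xh; rewrite theta0_cofaces //; have [xX hx] := xh.
  have hxc := proper_card hx; have xc := cardX _ xX.
  rewrite (_ : _.-1 = (#|x| - #|h|).-1 + (n.+1 - #|x|)); last lia.
  apply: manifold_join; [exact: manifold_interval|apply: IH; last lia|].
    by rewrite inE xX orbT.
  by move=> a b [_ ax] [_ xb]; rewrite ltset; apply: proper_trans xb.
(* [h] is a face of maximal dimension. *)
have [hn|hn] := leqP n.+1 #|h|.
  rewrite (_ : _ - _ = 0); last lia.
  by apply/seteqP; split=> // x [/cardX xc /proper_card hx]; lia.
rewrite -(prednK (n := n.+1 - #|h|)) ?subn_gt0 //.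
have ne : cofaces X h !=set0.
  have : exists2 g, g \in faces X n & h \subset g.
    move: h0X; rewrite !inE => /predU1P[->|/pure//].
    case: rX => [[//]|[k [[<-] _ [g gn]]]].
    by exists g; rewrite ?sub0set // inE; apply/asboolP.
  move=> [g /faceX[gX gc] hg]; exists g; split=> //.
  by rewrite properEcard hg gc.
split=> //.
(* [h] is an [(n-1)]-face, so its cofaces are the [n]-faces containing it; it
   is not empty since [0 < n]. *)
have [hn'|hn'] := leqP n #|h|.
  rewrite (_ : _.-1 = 0); last lia.
  have hc : #|h| = n by lia.
  have hX : h \in X.
    by move: h0X; rewrite !inE => /predU1P[h0|//]; rewrite h0 cards0 in hc; lia.
  have hf : h \in faces X n.-1 by apply/faceX; rewrite prednK.
  set G := finset (fun g => (g \in faces X n) && (h \subset g)).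
  have GE x : cofaces X h x <-> x \in G.
    rewrite inE; split=> [[xX hx]|/andP[/faceX[xX xn] hx]].
      rewrite proper_sub // andbT; apply/faceX; split=> //.
      by have := cardX _ xX; have := proper_card hx; lia.
    by split=> //; rewrite properEcard hx xn hc ltnSn.
  have [/eqP/cards1P[a Ga]|/eqP/cards2P[a [b [_ Gab]]]] := two h hf.
    exists a, a; apply/seteqP; split=> x; rewrite GE /G Ga.
      by move=> /set1P->; left.
    by move=> [] ->; rewrite inE.
  exists a, b; apply/seteqP; split=> x; rewrite GE /G Gab.
    by move=> /set2P[] ->; [left|right].
  by move=> [] ->; rewrite !inE eqxx ?orbT.
case E : (_.-1) => [|k]; first lia.
(* Here [h] is empty, and [X] itself is connected, or [h] has dimension at most
   [n-2], and its link is. *)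
move: h0X; rewrite !inE => /predU1P[->|hX].
  by rewrite cofaces0 //; exact: pseudomanifold_connected pX.
apply: cofaces_connected => //.
have [|m pL] := nX h hX; last exact: pseudomanifold_connected pL.
by rewrite /simplex_dim; lia.
Qed.

End Complexes.


Theorem theorem2 (V : finType) (n : nat) (X : {set {set V}})
    (hX : normal_pseudomanifold n X) :
  (border (face_poset X) = set0 /\ surface (Posz n) (face_poset X)) \/
  ((n <> 0%N -> (border (face_poset X) !=set0)%classic) /\
   PCM (Posz n) (face_poset X)).
Proof.
have [[cX rX topX] _] := hX.
have [n0|n0] := posnP n.
  right; split=> //; subst n; apply: PCM_0 => //.
  case: topX => [[_ [x ->]]|[//]]; exists x.
  by apply/seteqP; split=> y /= /set1P.
have := manifold_cofaces n0 hX (h := finset.set0);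
rewrite setU11 cards0 subn0 cofaces0 //.
move=> /(_ isT)/manifold_surface_or_PCM.
rewrite (_ : n.+1%:Z - 1 = n%:Z)%R; last lia.
case=> [sX|pX]; [left|right]; split=> //; first exact: surface_border0 rX sX.
by move=> _; apply: PCM_border pX; lia.
Qed.
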